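(* Let $\Gamma,\Delta$ be finite sets of formulas in $For_1$, not both empty. If the sequent $\Gamma \Rightarrow \Delta$ is provable in the sequent calculus $\mathbf{H}$, then $\vDash_{\mathbf{H}_3} \Gamma \Rightarrow \Delta$. In particular, if $\Gamma \Rightarrow \alpha$ is provable in $\mathbf{H}$ then $\Gamma \vDash_{\mathbf{H}_3} \alpha$.
   Context: Fix a denumerable set $prop$ of propositional variables. $For_1$ is the set of formulas built from $prop$ with a unary connective $\lnot$ and a binary connective $\vee$. For a formula $\alpha$, $var(\alpha)$ is the set of propositional variables occurring in $\alpha$, and $var(\Gamma)=\bigcup_{\gamma\in\Gamma}var(\gamma)$. A sequent $\Gamma\Rightarrow\Delta$ is an ordered pair of finite sets of formulas, not both empty; $\alpha,\Gamma$ and $\Gamma,\alpha$ denote $\Gamma\cup\{\alpha\}$. The calculus $\mathbf{H}$ has the axiom $\alpha\Rightarrow\alpha$ and the rules (premises / conclusion): (W$\Rightarrow$) $\Gamma\Rightarrow\Delta$ / $\alpha,\Gamma\Rightarrow\Delta$; ($\Rightarrow$W) $\Gamma\Rightarrow\Delta$ / $\Gamma\Rightarrow\Delta,\alpha$; (Cut) $\Gamma\Rightarrow\Delta,\alpha$ and $\alpha,\Gamma\Rightarrow\Delta$ / $\Gamma\Rightarrow\Delta$; ($\Rightarrow\lnot$) $\alpha,\Gamma\Rightarrow\Delta$ / $\Gamma\Rightarrow\Delta,\lnot\alpha$; ($\lnot^H\Rightarrow$) $\Gamma\Rightarrow\Delta,\alpha$ / $\lnot\alpha,\Gamma\Rightarrow\Delta$,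 allowed only if $var(\alpha)\subseteq var(\Delta)$; ($\vee\Rightarrow$) $\alpha_1,\Gamma\Rightarrow\Delta$ and $\alpha_2,\Gamma\Rightarrow\Delta$ / $\alpha_1\vee\alpha_2,\Gamma\Rightarrow\Delta$; ($\Rightarrow\vee$) $\Gamma\Rightarrow\Delta,\alpha_1,\alpha_2$ / $\Gamma\Rightarrow\Delta,\alpha_1\vee\alpha_2$. Halldén's logic $\mathbf{H}_3$ on $For_1$: truth values $\{1,\tfrac12,0\}$ with designated set $\{1,\tfrac12\}$; a valuation is a map $prop\to\{1,\tfrac12,0\}$ extended to formulas by $\lnot 1=0,\lnot\tfrac12=\tfrac12,\lnot 0=1$, and $x\vee y=\tfrac12$ if $x=\tfrac12$ or $y=\tfrac12$, otherwise classical disjunction on $\{0,1\}$. A valuation $v$ is a model of $\Gamma\Rightarrow\Delta$ if whenever $v(\gamma)$ is designated for all $\gamma\in\Gamma$, $v(\delta)$ is designated for some $\delta\in\Delta$; $\vDash_{\mathbf{H}_3}\Gamma\Rightarrow\Delta$ means every valuation is a model of it. $\Gamma\vDash_{\mathbf{H}_3}\alpha$ means every valuation designating all members of $\Gamma$ designates $\alpha$. *)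

(* Defs.v *)
From HB Require Import structures.
From mathcomp Require Import all_boot.
From mathcomp Require Import finmap.

Set Implicit Arguments.
Unset Strict Implicit.
Unset Printing Implicit Defensive.

Local Open Scope fset_scope.

Definition denumerable (P : Type) : Prop := exists f : nat -> P, bijective f.

Inductive form (P : Type) : Type :=
| Var of P
| Neg of form P
| Or of form P & form P.

(* Finite sets {fset form P} require a choiceType structure on form P, which is
   transported along an encoding into generic trees. *)
Fixpoint form_enc (P : Type) (a : form P) : GenTree.tree P :=
  match a with
  | Var p => GenTree.Leaf p
  | Neg b => GenTree.Node 0 [:: form_enc b]
  | Or b c => GenTree.Node 1 [:: form_enc b; form_enc c]
  end.

Fixpoint form_dec (P : Type) (t : GenTree.tree P) : option (form P) :=
  match t with
  | GenTree.Leaf p => Some (Var p)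
  | GenTree.Node 0 [:: u] => omap (@Neg P) (form_dec u)
  | GenTree.Node 1 [:: u; w] =>
      if form_dec u is Some b then omap (Or b) (form_dec w) else None
  | _ => None
  end.

Lemma form_encK (P : Type) : pcancel (@form_enc P) (@form_dec P).
Proof. by elim=> [p|b /= ->|b /= -> c /= ->]. Qed.

HB.instance Definition _ (P : choiceType) :=
  Choice.copy (form P) (pcan_type (@form_encK P)).

Fixpoint var (P : choiceType) (a : form P) : {fset P} :=
  match a with
  | Var p => [fset p]
  | Neg b => var b
  | Or b c => var b `|` var c
  end.

Definition vars (P : choiceType) (G : {fset form P}) : {fset P} :=
  \bigcup_(a <- G) var a.

(* A pair (G, D) is the sequent G => D exactly when this holds. *)
Definition is_sequent (P : choiceType) (G D : {fset form P}) : bool :=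
  (G != fset0) || (D != fset0).

(* Contexts are sets, so the principal and active formulas of a rule may already
   belong to G or D.  Cut is the only rule that could lead from sequents to the
   empty pair, hence the only one with an explicit is_sequent condition; see
   H_provable_sequent. *)
Inductive H_provable (P : choiceType) :
    {fset form P} -> {fset form P} -> Prop :=
| H_ax a : H_provable [fset a] [fset a]
| H_weakL a G D : H_provable G D -> H_provable (a |` G) D
| H_weakR a G D : H_provable G D -> H_provable G (a |` D)
| H_cut a G D : is_sequent G D ->
    H_provable G (a |` D) -> H_provable (a |` G) D -> H_provable G D
| H_negR a G D : H_provable (a |` G) D -> H_provable G (Neg a |` D)
| H_negL a G D : var a `<=` vars D ->
    H_provable G (a |` D) -> H_provable (Neg a |` G) D
| H_orL a b G D :
    H_provable (a |` G) D -> H_provable (b |` G) D ->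
    H_provable (Or a b |` G) D
| H_orR a b G D :
    H_provable G (a |` (b |` D)) -> H_provable G (Or a b |` D).

Lemma H_provable_sequent (P : choiceType) (G D : {fset form P}) :
  H_provable G D -> is_sequent G D.
Proof.
have neU (a : form P) A : a |` A != fset0.
  by apply/fset0Pn; exists a; rewrite fset1U1.
by case=> {G D} *; rewrite /is_sequent ?neU ?orbT // -(fsetU0 [fset _]) neU.
Qed.

Inductive tv : Type := T1 | Thalf | T0.

Definition tv_neg (x : tv) : tv :=
  match x with T1 => T0 | Thalf => Thalf | T0 => T1 end.

Definition tv_or (x y : tv) : tv :=
  match x, y with
  | Thalf, _ | _, Thalf => Thalf
  | T0, T0 => T0
  | _, _ => T1
  end.

Definition designated (x : tv) : bool :=
  match x with T1 | Thalf => true | T0 => false end.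

Fixpoint eval (P : Type) (v : P -> tv) (a : form P) : tv :=
  match a with
  | Var p => v p
  | Neg b => tv_neg (eval v b)
  | Or b c => tv_or (eval v b) (eval v c)
  end.

Definition model (P : choiceType) (v : P -> tv) (G D : {fset form P}) : Prop :=
  (forall c, c \in G -> designated (eval v c)) ->
  exists2 d, d \in D & designated (eval v d).

Definition H3_valid (P : choiceType) (G D : {fset form P}) : Prop :=
  forall v : P -> tv, model v G D.

Definition H3_entails (P : choiceType) (G : {fset form P}) (a : form P) : Prop :=
  forall v : P -> tv,
    (forall c, c \in G -> designated (eval v c)) -> designated (eval v a).

(* Main.v *)
Require Import Defs.
From mathcomp Require Import all_boot.
From mathcomp Require Import finmap.

Local Open Scope fset_scope.

(** The rule for negation on the left is the only one whose soundness is not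
    immediate: if [a] and [Neg a] are both designated then [a] takes the value
    1/2. Since 1/2 is infectious, a formula has value 1/2 exactly when one of its
    variables does, so some variable of [a] has value 1/2; by the proviso
    it occurs in a formula of the succedent, which then has value 1/2 too. *)

Lemma eval_Thalf (P : choiceType) (v : P -> tv) (a : form P) :
  eval v a = Thalf <-> exists2 p, p \in var a & v p = Thalf.
Proof.
elim: a => [p|a IHa|a IHa b IHb] /=.
- by split=> [vp|[q /fset1P -> //]]; exists p; rewrite ?fset11.
- by rewrite -IHa; case: (eval v a).
- have -> : tv_or (eval v a) (eval v b) = Thalf <->
      eval v a = Thalf \/ eval v b = Thalf.
    by case: (eval v a); case: (eval v b); intuition discriminate.
  rewrite IHa IHb; split=> [[] [p pV vp]|[p /fsetUP[] pV vp]].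
  + by exists p; rewrite // in_fsetU pV.
  + by exists p; rewrite // in_fsetU pV orbT.
  + by left; exists p.
  + by right; exists p.
Qed.

Lemma designated_neg (x : tv) : ~~ designated x -> designated (tv_neg x).
Proof. by case: x. Qed.

Lemma designated_neg_Thalf (x : tv) :
  designated x -> designated (tv_neg x) -> x = Thalf.
Proof. by case: x. Qed.

(** Infection does no harm to designation, because 1/2 is itself designated: a disjunction infected
    by 1/2 is designated and so is the infecting disjunct. On 0 and 1 the table is classical. *)
Lemma designated_or (x y : tv) :
  designated (tv_or x y) = designated x || designated y.
Proof. by case: x; case: y. Qed.

(** The two halves of [model] get names so that the lemmas on adding one formula can serve as
    views. *)
Definition all_designated (P : choiceType) (v : P -> tv) (G : {fset form P}) :=
  forall c, c \in G -> designated (eval v c).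

Definition some_designated (P : choiceType) (v : P -> tv) (D : {fset form P}) :=
  exists2 d, d \in D & designated (eval v d).

Lemma all_designatedU1 (P : choiceType) (v : P -> tv) (a : form P) G :
  all_designated P v (a |` G) <->
  designated (eval v a) /\ all_designated P v G.
Proof.
split=> [h|[ha hG] c /fset1UP[-> //|/hG //]].
by split=> [|c cG]; apply: h; rewrite ?fset1U1 ?fset1Ur.
Qed.

Lemma some_designatedU1 (P : choiceType) (v : P -> tv) (a : form P) D :
  some_designated P v (a |` D) <->
  designated (eval v a) \/ some_designated P v D.
Proof.
split=> [[d /fset1UP[-> da|dD dd]]|[da|[d dD dd]]].
- by left.
- by right; exists d.
- by exists a; rewrite ?fset1U1.
- by exists d; rewrite ?fset1Ur.
Qed.

Lemma some_designated_vars (P : choiceType) (v : P -> tv) (a : form P) D :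
  var a `<=` vars D -> eval v a = Thalf -> some_designated P v D.
Proof.
move=> /fsubsetP aD /eval_Thalf[p /aD /bigfcupP[d /andP[dD _] pd] vp].
exists d => //; suff -> : eval v d = Thalf by [].
by apply/eval_Thalf; exists p.
Qed.

Lemma H_sound (P : choiceType) (G D : {fset form P}) :
  H_provable G D -> H3_valid G D.
Proof.
(* The valuation is fixed before the induction: each rule preserves having [v] as a model, not
   merely validity. *)
move=> pf v; rewrite /model -/(all_designated P v G) -/(some_designated P v D).
elim: pf => {G D} [a|a G D _ IH|a G D _ IH|a G D _ _ IH1 _ IH2|a G D _ IH|
    a G D aD _ IH|a b G D _ IHa _ IHb|a b G D _ IH].
- by move=> h; exists a; rewrite ?fset11 // h ?fset11.
- by move=> /all_designatedU1[_ /IH].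
- by move=> /IH hD; apply/some_designatedU1; right.
- move=> hG; case/some_designatedU1: (IH1 hG) => // ha.
  by apply/IH2/all_designatedU1.
- move=> hG; apply/some_designatedU1 => /=.
  (* If [a] is undesignated, its negation is designated; otherwise the premise applies. *)
  case: (boolP (designated (eval v a))) => [ha|/designated_neg]; last by left.
  by right; apply/IH/all_designatedU1.
(* Either the premise already designates a member of [D], or [a] and [Neg a] are both designated, so
   [a] has value 1/2 and the proviso [aD] takes over. *)
- move=> /all_designatedU1[/= hna /IH /some_designatedU1[ha|//]].
  exact: some_designated_vars aD (designated_neg_Thalf _ ha hna).
- move=> /all_designatedU1[/=]; rewrite designated_or => /orP[] h hG.
  + exact/IHa/all_designatedU1.
  + exact/IHb/all_designatedU1.
- move=> /IH /some_designatedU1 h; apply/some_designatedU1.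
  rewrite /= designated_or; case: h => [->|/some_designatedU1[->|]].
  + by left.
  + by left; rewrite orbT.
  + by right.
Qed.

Theorem mainTheorem1 (P : choiceType) (hP : denumerable P) :
  (forall G D : {fset form P},
     is_sequent G D -> H_provable G D -> H3_valid G D) /\
  (forall (G : {fset form P}) (a : form P),
     H_provable G [fset a] -> H3_entails G a).
Proof.
(* In a singleton succedent the designated formula can only be [a]. *)
split=> [G D _|G a /H_sound valid v /valid [d /fset1P -> //]].
exact: H_sound.
Qed.
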